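(* A sequence of permutations $\sigma_i\in\mathfrak{S}_{n_i}$, $i\geq1$, $n_i\to\infty$, is quasirandom if and only if, for each $\epsilon>0$, given any $(\epsilon,\{f_s\})$-uniform partition of $\sigma_i$ with $i$ sufficiently large, $f_s(x)$ is $2\epsilon$-near $id(x)=x$ for each $s$.
   Context: $\mathfrak{S}_n$ is the set of permutations of $\mathbb{Z}_n$, where $\mathbb{Z}_n$ is identified with $\{0,1,\ldots,n-1\}$ with its usual linear order; an interval of $\mathbb{Z}_n$ is a set of consecutive integers in it. For $S,T\subset\mathbb{Z}_n$ let $D_T(S)=\left||S\cap T|-\frac{|S||T|}{n}\right|$, and for $\sigma\in\mathfrak{S}_n$ let $D(\sigma)=\max_{I,J}D_J(\sigma(I))$, the maximum over all intervals $I,J$ of $\mathbb{Z}_n$. A sequence $\sigma_i\in\mathfrak{S}_{n_i}$ is quasirandom if $D(\sigma_i)=o(n_i)$. A partition $\{C_j\}_{j=0}^k$ of $\sigma\in\mathfrak{S}_n$ means a partition of $\mathbb{Z}_n$ with a designated exceptional set $C_0$ and in which each $C_j$, $1\le j\le k$, is an interval. It is equitable if $|C_s|=|C_t|$ for all $1\le s,t\le k$. For $S\subset \mathbb{Z}_n$ and $\alpha\in[0,1]$, let $\mathcal{L}(S,\alpha) = |\sigma(S)\cap[0,\alpha n)|/|S|$. Two functions $f,g:[0,1]\to[0,1]$ are $\epsilon$-near if for each $\alpha\in[0,1]$, $g(\alpha-\epsilon)-\epsilon\leq f(\alpha)\leq g(\alpha+\epsilon)+\epsilon$, with the convention $g(\alpha)=g(0)$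 for $\alpha<0$ and $g(\alpha)=g(1)$ for $\alpha>1$. A partition $\{C_j\}_{j=0}^k$ of $\sigma$ is $(\epsilon,\{f_s\})$-uniform, where $\{f_s\}=\{f_s\}_{s=1}^k$ is a collection of functions $[0,1]\to[0,1]$, if it is equitable, $|C_0|\leq\epsilon n$, and for each $s\in\{1,\ldots,k\}$ and every interval $I\subset C_s$ with $|I|\geq\epsilon|C_s|$, the function $\mathcal{L}(I,\cdot)$ is $\epsilon$-near $f_s$.
   Formalization: ''i sufficiently large'' is read with a threshold depending on both ε and the number k of non-exceptional classes; with a threshold depending on ε alone the claim fails (the partition into singletons with f_s = L(C_s,·)). *)

(* Defs.v *)
From HB Require Import structures.
From mathcomp Require Import all_boot all_order all_algebra all_fingroup.
From mathcomp Require Import all_classical all_reals all_analysis.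

Set Implicit Arguments.
Unset Strict Implicit.
Unset Printing Implicit Defensive.

Import Order.TTheory GRing.Theory Num.Theory.
Import numFieldNormedType.Exports.

Local Open Scope ring_scope.

Section Intervals.
Variables (R : realType) (n : nat).

(* [Z_n] is ['I_n] with its usual order; the empty set counts as an interval,
   which changes no maximum below and is never a class of a partition. *)
Definition ord_interval (S : {set 'I_n}) : bool :=
  [exists a : 'I_n.+1, exists b : 'I_n.+1,
     S == [set x : 'I_n | (a <= x)%N && (x < b)%N]].

Definition set_discrepancy (T S : {set 'I_n}) : R :=
  `| #|S :&: T|%:R - #|S|%:R * #|T|%:R / n%:R |.

Definition perm_discrepancy (sigma : 'S_n) : R :=
  \big[Num.max/0]_(I : {set 'I_n} | ord_interval I)
    \big[Num.max/0]_(J : {set 'I_n} | ord_interval J)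
      set_discrepancy J (sigma @: I).

Definition image_cdf (sigma : 'S_n) (S : {set 'I_n}) (alpha : R) : R :=
  #|[set y in sigma @: S | (y : nat)%:R < alpha * n%:R]|%:R / #|S|%:R.

End Intervals.

(* Functions [0, 1] -> [0, 1] are functions [R -> R] constrained on [0, 1]. *)
Definition unit_interval_map (R : realType) (f : R -> R) : Prop :=
  forall x, 0 <= x <= 1 -> 0 <= f x <= 1.

(* Truncating the argument to [0, 1] implements the convention
   g(x) = g(0) for x < 0 and g(x) = g(1) for x > 1. *)
Definition clip01 (R : realType) (x : R) : R := Num.max 0 (Num.min 1 x).

Definition eps_near (R : realType) (eps : R) (f g : R -> R) : Prop :=
  forall alpha, 0 <= alpha <= 1 ->
    g (clip01 (alpha - eps)) - eps <= f alpha <= g (clip01 (alpha + eps)) + eps.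

(* The exceptional class [C0] is kept apart from the classes C_1, ..., C_k,
   which are indexed by ['I_k]; only [C0] may be empty. *)
Definition interval_partition (n k : nat) (C0 : {set 'I_n})
    (C : 'I_k -> {set 'I_n}) : Prop :=
  [/\ C0 :|: \bigcup_(s < k) C s = [set: 'I_n],
      forall s, [disjoint C0 & C s],
      forall s t, s != t -> [disjoint C s & C t],
      forall s, (0 < #|C s|)%N
    & forall s, ord_interval (C s)].

Definition equitable (n k : nat) (C : 'I_k -> {set 'I_n}) : Prop :=
  forall s t, #|C s| = #|C t|.

Definition uniform_partition (R : realType) (n k : nat) (sigma : 'S_n)
    (eps : R) (f : 'I_k -> R -> R)
    (C0 : {set 'I_n}) (C : 'I_k -> {set 'I_n}) : Prop :=
  [/\ interval_partition C0 C,
      equitable C,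
      #|C0|%:R <= eps * n%:R
    & forall (s : 'I_k) (I : {set 'I_n}),
        ord_interval I -> I \subset C s -> eps * #|C s|%:R <= #|I|%:R ->
        eps_near eps (image_cdf sigma I) (f s)].

Local Open Scope classical_set_scope.

Definition quasirandom (R : realType) (n : nat -> nat)
    (sigma : forall i, 'S_(n i)) : Prop :=
  (fun i => perm_discrepancy R (sigma i)) =o_\oo (fun i => (n i)%:R : R).

(* Main.v *)
Require Import Defs.
From HB Require Import structures.
From mathcomp Require Import all_boot all_order all_algebra all_fingroup.
From mathcomp Require Import all_classical all_reals all_analysis.
From mathcomp Require Import zify ring lra.

Import Order.TTheory GRing.Theory Num.Theory.
Import numFieldNormedType.Exports.

(* If [sigma] is quasirandom, [image_cdf (C s)] is uniformly close to the
   identity because each [C s] has linear size, and [f s] is near it.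

   Conversely, cut Z_n into equal blocks, each split into K equal sub-blocks at
   the next level, and follow the indicators of [sigma x < alpha n] for alpha in
   a finite grid. The mean square of their block averages increases with the
   level and is bounded, so at some level of bounded depth almost all blocks are
   regular: their sub-blocks have nearly the same averages, hence so do all
   their long subintervals. The regular blocks form a uniform partition with
   boundedly many classes, and if all the functions [f s] of such a partition
   are near the identity, summing over the classes bounds the discrepancy by
   14 eps n. *)

Local Open Scope classical_set_scope.
Local Open Scope ring_scope.

(** * Block averages and energy increment *)

Section BlockEnergy.
Variable R : realType.
Implicit Types (g : nat -> R) (K L N p : nat).

Definition block_avg g L p : R := (\sum_(p * L <= y < p.+1 * L) g y) / L%:R.

(** The variance of the averages of the [K] sub-blocks of block [p]. *)
Definition spread g L K p : R :=
  (\sum_(p * K <= c < p.+1 * K)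
     (block_avg g L c - block_avg g (K * L) p) ^+ 2) / K%:R.

Definition energy g L N : R := (\sum_(0 <= p < N) block_avg g L p ^+ 2) / N%:R.

Lemma sum_over_blocks g L a b : (a <= b)%N ->
  \sum_(a * L <= y < b * L) g y =
  \sum_(a <= c < b) \sum_(c * L <= y < c.+1 * L) g y.
Proof.
elim: b => [|b IHb].
  by rewrite leqn0 => /eqP ->; rewrite !big_geq.
rewrite leq_eqVlt => /predU1P[<-|]; first by rewrite !big_geq.
rewrite ltnS => leab; rewrite big_nat_recr //= -IHb //.
by rewrite -big_cat_nat ?leq_mul2r ?leab ?leqnSn ?orbT.
Qed.

Lemma block_avg_refine g L K p : (0 < L)%N ->
  block_avg g (K * L) p = (\sum_(p * K <= c < p.+1 * K) block_avg g L c) / K%:R.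
Proof.
move=> L0; rewrite /block_avg !mulnA sum_over_blocks ?leq_mul2r ?leqnSn ?orbT //.
by rewrite -mulr_suml natrM invfM (mulrC K%:R^-1) mulrA.
Qed.

Lemma sum_nat_range_const (a b : nat) (c : R) :
  \sum_(a <= y < b) c = (b - a)%:R * c.
Proof. by rewrite sumr_const_nat mulr_natl. Qed.

Lemma block_avg_itv g L p : (0 < L)%N -> (forall y, 0 <= g y <= 1) ->
  0 <= block_avg g L p <= 1.
Proof.
move=> L0 g01; rewrite /block_avg divr_ge0 ?sumr_ge0 //=; last first.
  by move=> y _; case/andP: (g01 y).
rewrite ler_pdivrMr ?ltr0n // mul1r.
apply: (@le_trans _ _ (\sum_(p * L <= y < p.+1 * L) 1)).
  by apply: ler_sum => y _; case/andP: (g01 y).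
by rewrite sum_nat_range_const mulr1 ler_nat mulSn addnK.
Qed.

Lemma energy_itv g L N : (0 < L)%N -> (0 < N)%N -> (forall y, 0 <= g y <= 1) ->
  0 <= energy g L N <= 1.
Proof.
move=> L0 N0 g01; rewrite /energy divr_ge0 ?sumr_ge0 //=; last first.
  by move=> y _; rewrite sqr_ge0.
rewrite ler_pdivrMr ?ltr0n // mul1r.
apply: (@le_trans _ _ (\sum_(0 <= y < N) 1)).
  apply: ler_sum => y _; have /andP[h0 h1] := block_avg_itv g L y L0 g01.
  by rewrite expr_le1.
by rewrite sum_nat_range_const mulr1 subn0.
Qed.

Lemma spread_ge0 g L K p : 0 <= spread g L K p.
Proof. by rewrite divr_ge0 ?sumr_ge0 // => c _; rewrite sqr_ge0. Qed.

Lemma spreadE g L K p : (0 < L)%N -> (0 < K)%N ->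
  spread g L K p =
  (\sum_(p * K <= c < p.+1 * K) block_avg g L c ^+ 2) / K%:R
  - block_avg g (K * L) p ^+ 2.
Proof.
move=> L0 K0; have K0' : K%:R != 0 :> R by rewrite pnatr_eq0 -lt0n.
rewrite /spread.
have := block_avg_refine g L K p L0; set A := block_avg g (K * L) p => AE.
under eq_bigr do rewrite sqrrB.
rewrite big_split /= sumrB sumrMnl -mulr_suml.
have -> : \sum_(p * K <= c < p.+1 * K) block_avg g L c = K%:R * A.
  by rewrite AE mulrC divfK.
rewrite sum_nat_range_const mulSn addnK mulr2n.
by field.
Qed.

(** Pythagoras: on each block, the mean of the squared sub-block averages is the squared block
    average plus their variance. *)
Lemma energy_refine g L K N : (0 < L)%N -> (0 < K)%N ->
  energy g L (N * K) = energy g (K * L) N + (\sum_(0 <= p < N) spread g L K p) / N%:R.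
Proof.
move=> L0 K0; rewrite /energy big_nat_mul -mulrDl -big_split /=.
under [in RHS]eq_bigr do rewrite spreadE // addrC subrK.
by rewrite -mulr_suml natrM invfM (mulrC N%:R^-1) mulrA.
Qed.

Definition irregular_blocks {m : nat} (g : 'I_m -> nat -> R) (delta : R) L K N
    : {set 'I_N} :=
  [set p : 'I_N | [exists i, delta ^+ 2 < spread (g i) L K p]].

(* Each level with too many irregular blocks raises the total energy, which
   is at most m, by a fixed amount. *)
Lemma exists_regular_level (m K : nat) (delta eta : R) :
    (0 < K)%N -> 0 < delta -> 0 < eta ->
  exists T : nat, forall (q : nat) (g : 'I_m -> nat -> R), (0 < q)%N ->
    (forall i y, 0 <= g i y <= 1) ->
  exists2 t, (t < T)%N &
    #|irregular_blocks g delta (q * K ^ (T - t.+1)) K (K ^ t)|%:R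
      <= eta * (K ^ t)%:R.
Proof.
move=> K0 d0 e0.
have c0 : 0 < eta * delta ^+ 2 by rewrite mulr_gt0 ?exprn_gt0.
(* [T] gains of [eta * delta ^+ 2] each would push the energy beyond its bound [m]. *)
exists (Num.bound (m%:R / (eta * delta ^+ 2))).
set T := Num.bound _ => q g q0 g01.
have mT : m%:R < T%:R * (eta * delta ^+ 2).
  rewrite -ltr_pdivrMr //; apply: archi_boundP.
  by rewrite divr_ge0 // ltW.
apply: contrapT => noreg.
(* Level [t] has [K ^ t] blocks of length [q * K ^ (T - t)], so all levels cover the same
   [q * K ^ T] points. *)
pose E t := \sum_i energy (g i) (q * K ^ (T - t)) (K ^ t).
have L0 t : (0 < q * K ^ t)%N by rewrite muln_gt0 q0 expn_gt0 K0.
have Em t : E t <= m%:R.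
  apply: (@le_trans _ _ (\sum_(i < m) 1)).
    apply: ler_sum => i _; have KT : (0 < K ^ t)%N by rewrite expn_gt0 K0.
    by have /andP[] := energy_itv (g i) _ _ (L0 (T - t)%N) KT (g01 i).
  by rewrite sumr_const card_ord.
suff Eg t : (t <= T)%N -> t%:R * (eta * delta ^+ 2) <= E t.
  by have := le_lt_trans (le_trans (Eg T (leqnn T)) (Em T)) mT; rewrite ltxx.
elim: t => [_|t IHt tT].
  rewrite mul0r; apply: sumr_ge0 => i _.
  by have /andP[] := energy_itv (g i) _ _ (L0 (T - 0)%N) (isT : 0 < K ^ 0)%N (g01 i).
have Kt0 : 0 < (K ^ t)%:R :> R by rewrite ltr0n expn_gt0 K0.
set L := (q * K ^ (T - t.+1))%N.
have EE : E t.+1 = E t + (\sum_i \sum_(p < K ^ t) spread (g i) L K p) / (K ^ t)%:R.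
  rewrite /E mulr_suml -big_split /=; apply: eq_bigr => i _.
  rewrite expnSr energy_refine // big_mkord /L mulnCA -expnS.
  by rewrite -subSn // subSS.
rewrite -natr1 mulrDl mul1r EE lerD ?IHt // 1?ltnW // ler_pdivlMr //.
rewrite exchange_big /=.
have irr : eta * (K ^ t)%:R < #|irregular_blocks g delta L K (K ^ t)|%:R.
  by rewrite ltNge; apply/negP => h; apply: noreg; exists t.
rewrite mulrAC (le_trans (ler_wpM2r (sqr_ge0 _) (ltW irr))) //.
(* The irregular blocks alone give the gain: each has spread above [delta ^+ 2] for some [i], and
   all other terms are nonnegative. *)
rewrite (bigID (mem (irregular_blocks g delta L K (K ^ t)))) /=.
rewrite -[leLHS]addr0 lerD ?sumr_ge0 //; last first.
  by move=> p _; apply: sumr_ge0 => i _; apply: spread_ge0.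
rewrite mulr_natl -sumr_const; apply: ler_sum => p.
rewrite inE => /existsP[i ip]; rewrite (bigD1 i) //=.
rewrite -[leLHS]addr0 lerD ?(ltW ip) ?sumr_ge0 // => j _; exact: spread_ge0.
Qed.

(** Round [x] down to a multiple of [L]. Over the [K] sub-blocks the mean square deviation is at
    most [delta ^+ 2], hence the mean deviation at most [delta]; the sub-block cut by [x]
    contributes at most [L]. *)
Lemma regular_block_prefix g L K p x (delta : R) : (0 < L)%N -> (0 < K)%N ->
    0 < delta -> (forall y, 0 <= g y <= 1) -> spread g L K p <= delta ^+ 2 ->
    (p * (K * L) <= x <= p.+1 * (K * L))%N ->
  `|\sum_(p * (K * L) <= y < x) (g y - block_avg g (K * L) p)|
    <= (K * L)%:R * delta + L%:R.
Proof.
move=> L0 K0 d0 g01 sp /andP[px xp].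
have K0' : 0 < K%:R :> R by rewrite ltr0n.
have L0' : 0 < L%:R :> R by rewrite ltr0n.
set A := block_avg g (K * L) p; set j := (x %/ L)%N.
have A01 : 0 <= A <= 1 by apply: block_avg_itv; rewrite // muln_gt0 K0.
have pj : (p * K <= j)%N by rewrite /j leq_divRL // -mulnA.
have jp : (j <= p.+1 * K)%N by rewrite /j -(mulnK (p.+1 * K) L0) leq_div2r // -mulnA.
have jx : (j * L <= x)%N by exact: leq_divM.
rewrite (@big_cat_nat _ _ _ (j * L)) //=; last by rewrite mulnA leq_mul2r pj orbT.
apply: (le_trans (ler_normD _ _)); apply: lerD.
  rewrite mulnA sum_over_blocks // (le_trans (ler_norm_sum _ _ _)) //.
  have blk c : \sum_(c * L <= y < c.+1 * L) (g y - A) = L%:R * (block_avg g L c - A).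
    rewrite sumrB sum_nat_range_const mulSn addnK mulrBr; congr (_ - _).
    by rewrite /block_avg mulrC mulSn divfK // gt_eqF.
  under eq_bigr do rewrite blk normrM (ger0_norm (ltW L0')).
  rewrite -mulr_sumr natrM mulrAC mulrC ler_wpM2r ?(ltW L0') //.
  apply: (@le_trans _ _ (\sum_(p * K <= c < p.+1 * K) `|block_avg g L c - A|)).
    rewrite [leRHS](big_cat_nat pj jp) /= lerDl sumr_ge0 //.
  (* AM-GM: [|z| <= (z^2 / delta + delta) / 2] *)
  apply: (@le_trans _ _ (\sum_(p * K <= c < p.+1 * K)
      ((block_avg g L c - A) ^+ 2 / (2 * delta) + delta / 2))).
    apply: ler_sum => c _; rewrite -(real_normK (num_real _)); set z := `|_|.
    rewrite -subr_ge0.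
    have -> : z ^+ 2 / (2 * delta) + delta / 2 - z = (z - delta) ^+ 2 / (2 * delta).
      by field; rewrite gt_eqF.
    by rewrite divr_ge0 ?sqr_ge0 // mulr_ge0 // ltW.
  rewrite big_split /= sum_nat_range_const mulSn addnK -mulr_suml.
  rewrite /spread -/A ler_pdivrMr // in sp.
  rewrite (_ : K%:R * delta = delta ^+ 2 * K%:R / (2 * delta) + K%:R * (delta / 2)); last first.
    by field; rewrite gt_eqF.
  by rewrite lerD2r ler_wpM2r // invr_ge0 mulr_ge0 // ltW.
apply: (le_trans (ler_norm_sum _ _ _)).
apply: (@le_trans _ _ (\sum_(j * L <= y < x) 1)).
  apply: ler_sum => y _; have := g01 y; rewrite ler_norml; lra.
rewrite sum_nat_range_const mulr1 ler_nat leq_subLR /j.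
by rewrite {1}(divn_eq x L) leq_add2l ltnW // ltn_mod.
Qed.

(** An interval is the difference of two prefixes, hence the factor 2. *)
Lemma regular_block_interval g L K p a b (delta : R) : (0 < L)%N -> (0 < K)%N ->
    0 < delta -> (forall y, 0 <= g y <= 1) -> spread g L K p <= delta ^+ 2 ->
    (p * (K * L) <= a)%N -> (a <= b)%N -> (b <= p.+1 * (K * L))%N ->
  `|\sum_(a <= y < b) (g y - block_avg g (K * L) p)|
    <= 2 * ((K * L)%:R * delta + L%:R).
Proof.
move=> L0 K0 d0 g01 sp pa ab bp.
have Ha := regular_block_prefix g L K p a delta L0 K0 d0 g01 sp.
have Hb := regular_block_prefix g L K p b delta L0 K0 d0 g01 sp.
rewrite pa (leq_trans ab bp) in Ha; rewrite (leq_trans pa ab) bp in Hb.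
have := Hb isT; rewrite (big_cat_nat pa ab) /=; have := Ha isT.
by rewrite !ler_norml; lra.
Qed.

End BlockEnergy.

(** * Intervals of Z_n and counts of image points *)

Section OrdIntervals.
Variables (R : realType) (n : nat).
Implicit Types (S I J : {set 'I_n}).

Lemma ord_intervalP S :
  reflect (exists a b, (b <= n)%N /\ S = [set x : 'I_n | (a <= x)%N && (x < b)%N]%SET)
          (ord_interval S).
Proof.
apply: (iffP existsP) => [[a /existsP[b /eqP->]]|[a [b [bn ->]]]].
  by exists a, b; split=> //; rewrite -ltnS.
(* [a] may exceed [n]; the set is then empty, and truncating [a] keeps it so. *)
exists (inord (minn a n)); apply/existsP; exists (inord b); apply/eqP/setP => x.
rewrite !inE !inordK ?ltnS ?geq_minr //.
by have := ltn_ord x; lia.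
Qed.

Lemma sum_ord_interval (F : nat -> R) (a b : nat) : (b <= n)%N ->
  \sum_(x in [set x : 'I_n | (a <= x)%N && (x < b)%N]%SET) F x =
  \sum_(a <= y < b) F y.
Proof.
move=> bn; rewrite big_geq_mkord (big_ord_widen_cond n) //.
by apply: eq_bigl => x; rewrite inE.
Qed.

Lemma card_ord_interval (a b : nat) : (b <= n)%N ->
  #|[set x : 'I_n | (a <= x)%N && (x < b)%N]%SET| = (b - a)%N.
Proof.
move=> bn; apply/eqP; rewrite -(eqr_nat R) -sum1_card natr_sum.
by rewrite (sum_ord_interval (fun=> 1%:R)) // sum_nat_range_const mulr1.
Qed.

Variable sigma : 'S_n.

(** An indicator indexed by the position [x] rather than by its image, so that counts of images
    become sums over positions. *)
Definition below (x : 'I_n) (alpha : R) : R :=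
  ((sigma x)%:R < alpha * n%:R)%R%:R.

Lemma card_image_below S (alpha : R) :
  #|[set y in sigma @: S | (y : nat)%:R < alpha * n%:R]%SET|%:R =
  \sum_(x in S) below x alpha.
Proof.
rewrite -sum1_card natr_sum.
rewrite (eq_bigl (fun y => (y \in sigma @: S) && ((y : nat)%:R < alpha * n%:R)));
  last by move=> y; rewrite !inE.
rewrite big_mkcondr /= big_imset /=; last by move=> x y _ _; apply: perm_inj.
by apply: eq_bigr => x _; rewrite /below; case: ifP.
Qed.

Lemma image_cdfE S (alpha : R) :
  image_cdf sigma S alpha = (\sum_(x in S) below x alpha) / #|S|%:R.
Proof. by rewrite /image_cdf card_image_below. Qed.

Lemma sum_belowE S (alpha : R) : (0 < #|S|)%N ->
  \sum_(x in S) below x alpha = image_cdf sigma S alpha * #|S|%:R.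
Proof. by move=> S0; rewrite image_cdfE divfK // pnatr_eq0 -lt0n. Qed.

Lemma below_itv x (alpha : R) : 0 <= below x alpha <= 1.
Proof. by rewrite /below; case: (_ < _); rewrite ?lexx ler01. Qed.

Lemma image_cdf_itv S (alpha : R) : 0 <= image_cdf sigma S alpha <= 1.
Proof.
rewrite image_cdfE divr_ge0 ?sumr_ge0 //=.
have [->|S0] := posnP #|S|; first by rewrite invr0 mulr0 ler01.
rewrite ler_pdivrMr ?ltr0n // mul1r -sum1_card natr_sum; apply: ler_sum => x _.
by case/andP: (below_itv x alpha).
Qed.

Lemma le_image_cdf S : {homo image_cdf sigma S : a b / a <= b :> R}.
Proof.
move=> a b ab; rewrite !image_cdfE ler_wpM2r ?invr_ge0 //.
apply: ler_sum => x _; rewrite /below.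
case: (ltP _ (a * _)) => [h|_]; last by rewrite ler0n.
by rewrite (lt_le_trans h) // ler_wpM2r.
Qed.

(** [d] is the ceiling of [alpha * n]. It turns the values below [alpha * n] into an interval, to
    which the discrepancy applies. *)
Lemma initial_segment (alpha : R) : 0 <= alpha <= 1 ->
  exists2 d : nat, (d <= n)%N &
    `|d%:R - alpha * n%:R| <= 1 /\
    forall y : 'I_n, ((y : nat)%:R < alpha * n%:R) = (y < d)%N.
Proof.
move=> /andP[a0 a1].
have z0 : 0 <= alpha * n%:R by rewrite mulr_ge0.
have zn : alpha * n%:R <= n%:R by rewrite ler_piMl.
have := truncn_itv z0; set t := Num.trunc _ => /andP[tz zt].
rewrite -natr1 in zt.
have [tz'|zt'] := ltP (t%:R) (alpha * n%:R).
  exists t.+1; first by rewrite -(ltr_nat R) (lt_le_trans tz').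
  split; first by rewrite -natr1 ler_norml; lra.
  move=> y; apply/idP/idP => [h|]; rewrite ltnS.
    by rewrite -ltnS -(ltr_nat R) -natr1 (lt_trans h).
  by rewrite -(ler_nat R) => h; apply: le_lt_trans tz'.
have e : t%:R = alpha * n%:R by apply/eqP; rewrite eq_le tz.
exists t; first by rewrite -(ler_nat R) e.
split; first by rewrite e subrr normr0.
by move=> y; rewrite -e ltr_nat.
Qed.

(** The added 1 pays for rounding [alpha * n] to an integer, which moves the expected count by at
    most [#|S| / n <= 1]. *)
Lemma discrepancy_sum_below S (alpha : R) : (0 < n)%N -> ord_interval S ->
  0 <= alpha <= 1 ->
  `|\sum_(x in S) below x alpha - alpha * #|S|%:R|
    <= perm_discrepancy R sigma + 1.
Proof.
move=> n0 oS a01; have n0' : 0 < n%:R :> R by rewrite ltr0n.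
have [d dn [dist dE]] := initial_segment alpha a01.
pose J := [set x : 'I_n | (0 <= x)%N && (x < d)%N]%SET.
have oJ : ord_interval J by apply/ord_intervalP; exists 0%N, d.
have cJ : #|J| = d by rewrite card_ord_interval // subn0.
have le : set_discrepancy R J (sigma @: S) <= perm_discrepancy R sigma.
  rewrite /perm_discrepancy.
  apply: le_trans (le_bigmax_cond 0
    (fun I => \big[Num.max/0]_(J | ord_interval J) set_discrepancy R J (sigma @: I)) oS).
  exact: (le_bigmax_cond 0 (fun J => set_discrepancy R J (sigma @: S)) oJ).
have -> : \sum_(x in S) below x alpha - alpha * #|S|%:R =
  (#|(sigma @: S) :&: J|%:R - #|sigma @: S|%:R * #|J|%:R / n%:R)
  + #|S|%:R / n%:R * (d%:R - alpha * n%:R).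
  rewrite -card_image_below cJ card_imset; last exact: perm_inj.
  rewrite (_ : [set y in _ | _]%SET = (sigma @: S) :&: J)%SET; last first.
    by apply/setP => y; rewrite !inE dE.
  by field; rewrite gt_eqF.
apply: (le_trans (ler_normD _ _)); apply: lerD => //.
rewrite normrM ger0_norm ?divr_ge0 // mulr_ile1 ?divr_ge0 //.
rewrite ler_pdivrMr // mul1r ler_nat -[leqRHS]card_ord max_card //.
Qed.

End OrdIntervals.

(** * Splitting sums along a partition *)

Section PartitionSums.
Variables (R : realType) (n k : nat) (C0 : {set 'I_n}) (C : 'I_k -> {set 'I_n}).
Hypothesis part : interval_partition C0 C.

Lemma sum_interval_partition (I : {set 'I_n}) (E : 'I_n -> R) :
  \sum_(x in I) E x =
  \sum_(x in I :&: C0) E x + \sum_s \sum_(x in I :&: C s) E x.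
Proof.
case: part => cov d0 d _ _.
have dI s t : s != t -> [disjoint I :&: C s & I :&: C t]%B.
  move=> /d; apply: fintype.disjointW; apply: finset.subsetIr.
rewrite -(partition_disjoint_bigcup _ E dI).
rewrite -bigU /=; last first.
  apply: fintype.disjointWl (finset.subsetIr _ _) _.
  apply/bigcup_disjointP => s _.
  by apply: fintype.disjointWr (finset.subsetIr _ _) (d0 s).
apply: eq_bigl => x; rewrite !inE.
have : x \in C0 :|: \bigcup_(s < k) C s by rewrite cov inE.
rewrite inE; case: (x \in C0) => /=.
  case xI: (x \in I) => //= _; apply/esym/negbTE/bigcupP => -[s _].
  by rewrite inE xI.
rewrite andbF /= => /bigcupP[s _ xs]; apply/idP/bigcupP => [xI|[t _]].
  by exists s; rewrite // inE xI.
by rewrite inE => /andP[].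
Qed.

Lemma card_interval_partition : (#|C0| + \sum_s #|C s|)%N = n.
Proof.
apply/eqP; rewrite -(eqr_nat R) natrD natr_sum.
have := sum_interval_partition [set: 'I_n] (fun=> 1).
rewrite finset.setTI sumr_const cardsT card_ord => ->.
rewrite sumr_const; apply/eqP; congr (_ + _).
by apply: eq_bigr => s _; rewrite finset.setTI sumr_const.
Qed.

End PartitionSums.

(** * Nearness to the identity *)

Section EpsNear.
Variable R : realType.
Implicit Types (eps x y : R) (f g : R -> R).

Lemma clip01_le x y : 0 <= y -> x <= y -> clip01 x <= y.
Proof. by move=> y0 xy; rewrite /clip01 ge_max y0 ge_min xy orbT. Qed.

Lemma clip01_ge x y : y <= 1 -> y <= x -> y <= clip01 x.
Proof. by move=> y1 yx; rewrite /clip01 le_max le_min y1 yx orbT. Qed.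

Lemma clip01_id x : 0 <= x <= 1 -> clip01 x = x.
Proof.
by move=> /andP[x0 x1]; apply/eqP; rewrite eq_le clip01_le // clip01_ge.
Qed.

Lemma clip01_itv x : 0 <= clip01 x <= 1.
Proof. by rewrite /clip01 le_max lexx ge_max ler01 ge_min lexx. Qed.

(** Nearness at [alpha - eps] bounds [f alpha] from below, at [alpha + eps] from above. Each way the
    loss is [eps] for the shift, [2 * eps] for [g] against the identity and [eps] for nearness: the
    [4 * eps] that the conclusion allows. Close to the ends of [0, 1] the range of [f] suffices. *)
Lemma near_id_of_near eps f g : 0 < eps -> unit_interval_map f ->
  eps_near eps g f ->
  (forall alpha, 0 <= alpha <= 1 -> `|g alpha - alpha| <= 2 * eps) ->
  eps_near (2 * eps) f id.
Proof.
move=> e0 f01 gf g_id alpha a01; have /andP[fa0 fa1] := f01 _ a01.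
have ca := clip01_id _ a01.
have /andP[c0 _] := clip01_itv (alpha - 2 * eps).
apply/andP; split.
  have [a2|a2] := leP alpha (2 * eps).
    suff : clip01 (alpha - 2 * eps) <= 0 by lra.
    by apply: clip01_le; lra.
  have b01 : 0 <= alpha - eps <= 1 by lra.
  have /andP[_] := gf _ b01; rewrite subrK ca.
  have := g_id _ b01; rewrite ler_norml.
  have : clip01 (alpha - 2 * eps) <= alpha - 2 * eps by apply: clip01_le; lra.
  by lra.
have [a2|a2] := leP (1 - 2 * eps) alpha.
  suff : 1 <= clip01 (alpha + 2 * eps) by lra.
  by apply: clip01_ge; lra.
have b01 : 0 <= alpha + eps <= 1 by lra.
have /andP[+ _] := gf _ b01; rewrite addrK ca.
have := g_id _ b01; rewrite ler_norml.
have : alpha + 2 * eps <= clip01 (alpha + 2 * eps) by apply: clip01_ge; lra.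
by lra.
Qed.

(** The argument shifts add up to [3 * eps], as do the value errors; for the identity a shift is a
    value error too, whence 6. *)
Lemma near_near_id eps f g alpha : 0 < eps ->
  eps_near eps g f -> eps_near (2 * eps) f id -> 0 <= alpha <= 1 ->
  `|g alpha - alpha| <= 6 * eps.
Proof.
move=> e0 gf f_id a01.
have /andP[g1 g2] := gf _ a01.
have /andP[lo _] := f_id _ (clip01_itv (alpha - eps)).
have /andP[_ hi] := f_id _ (clip01_itv (alpha + eps)).
have c1 : alpha - eps <= clip01 (alpha - eps) by apply: clip01_ge; lra.
have c2 : clip01 (alpha + eps) <= alpha + eps by apply: clip01_le; lra.
have := clip01_itv (alpha - eps); have := clip01_itv (alpha + eps) => h1 h2.
have c3 : alpha - 3 * eps <= clip01 (clip01 (alpha - eps) - 2 * eps).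
  by apply: clip01_ge; lra.
have c4 : clip01 (clip01 (alpha + eps) + 2 * eps) <= alpha + 3 * eps.
  by apply: clip01_le; lra.
rewrite ler_norml; lra.
Qed.

End EpsNear.


(** * Discrepancy against uniform partitions *)

(** If [2 * eps < 1], then [C0] takes at most half of Z_n, so each class has at least [n / (2 k)]
    points and the discrepancy is at most [2 * eps] times its size. *)
Lemma near_id_of_small_discrepancy (R : realType) (n k : nat) (sigma : 'S_n)
    (eps : R) (f : 'I_k -> R -> R) (C0 : {set 'I_n}) (C : 'I_k -> {set 'I_n}) :
  0 < eps -> (forall s, unit_interval_map (f s)) ->
  uniform_partition sigma eps f C0 C ->
  k%:R * (perm_discrepancy R sigma + 1) <= eps * n%:R ->
  forall s, eps_near (2 * eps) (f s) id.
Proof.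
move=> e0 f01 [part equi cC0 unif] small s.
(* For [2 * eps >= 1] the error term alone covers [0, 1]. *)
have [e2|e2] := leP 1 (2 * eps).
  move=> alpha a01; have := f01 s _ a01.
  have := clip01_itv _ (alpha - 2 * eps); have := clip01_itv _ (alpha + 2 * eps).
  by lra.
have [_ _ _ C_gt0 oC] := part.
have c0 : 0 < #|C s|%:R :> R by rewrite ltr0n.
have n0 : (0 < n)%N.
  by rewrite -[n]card_ord (leq_trans (C_gt0 s)) // max_card.
have ncard : n%:R = #|C0|%:R + k%:R * #|C s|%:R :> R.
  rewrite -{1}(card_interval_partition R _ _ _ _ part) natrD natr_sum.
  under eq_bigr do rewrite (equi _ s).
  by rewrite sumr_const card_ord mulr_natl.
have k0 : 0 < k%:R :> R by rewrite ltr0n (leq_ltn_trans _ (ltn_ord s)).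
have n0' : 0 < n%:R :> R by rewrite ltr0n.
have nk : n%:R <= 2 * (k%:R * #|C s|%:R) :> R.
  have : 0 <= (1 - 2 * eps) * n%:R by apply: mulr_ge0; lra.
  by lra.
have Dle : perm_discrepancy R sigma + 1 <= 2 * eps * #|C s|%:R.
  rewrite -(ler_pM2l k0) (le_trans small) //.
  have -> : k%:R * (2 * eps * #|C s|%:R) = eps * (2 * (k%:R * #|C s|%:R)) by ring.
  by rewrite ler_wpM2l // ltW.
apply: (@near_id_of_near _ eps _ (image_cdf sigma (C s))) => //.
  by apply: unif; rewrite ?oC ?subxx // ler_piMl // 1?ltW //; lra.
move=> alpha a01; rewrite -(ler_pM2r c0) (le_trans _ Dle) //.
rewrite -{1}(ger0_norm (ltW c0)) -normrM mulrBl -sum_belowE //.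
exact: discrepancy_sum_below.
Qed.

(** In each class a long part of [I] is controlled by [near_near_id], with constant 6, and a short
    part by its size; the part in [C0] costs one more [eps * n]. *)
Lemma sum_below_near_id (R : realType) (n k : nat) (sigma : 'S_n)
    (eps : R) (f : 'I_k -> R -> R) (C0 : {set 'I_n}) (C : 'I_k -> {set 'I_n}) :
  0 < eps -> uniform_partition sigma eps f C0 C ->
  (forall s, eps_near (2 * eps) (f s) id) ->
  forall (I : {set 'I_n}) (alpha : R), ord_interval I -> 0 <= alpha <= 1 ->
  `|\sum_(x in I) below R n sigma x alpha - alpha * #|I|%:R| <= 7 * (eps * n%:R).
Proof.
move=> e0 [part equi cC0 unif] f_id I alpha oI a01.
have [_ _ _ C_gt0 oC] := part.
pose E x := below R n sigma x alpha - alpha.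
have sumE (S : {set 'I_n}) :
    \sum_(x in S) E x = \sum_(x in S) below R n sigma x alpha - alpha * #|S|%:R.
  by rewrite sumrB sumr_const mulr_natr.
have triv (S : {set 'I_n}) : `|\sum_(x in S) E x| <= #|S|%:R.
  apply: (le_trans (ler_norm_sum _ _ _)); rewrite -sum1_card natr_sum.
  apply: ler_sum => x _; rewrite /E ler_norml.
  move: (below R n sigma x alpha) (below_itv R n sigma x alpha) => z; clear E sumE.
  by lra.
have oIC s : ord_interval (I :&: C s).
  have /ord_intervalP[a [b [bn ->]]] := oI.
  have /ord_intervalP[a' [b' [bn' ->]]] := oC s.
  apply/ord_intervalP; exists (maxn a a'), (minn b b'); split; first lia.
  by apply/setP => x; rewrite !inE; lia.
have piece s : `|\sum_(x in I :&: C s) E x| <= 6 * eps * #|C s|%:R.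
  have c0 : 0 < #|C s|%:R :> R by rewrite ltr0n.
  have [small|big] := leP #|I :&: C s|%:R (eps * #|C s|%:R).
    by apply: (le_trans (triv _)); apply: (le_trans small); nra.
  have i0 : 0 < #|I :&: C s|%:R :> R by apply: lt_trans big; rewrite mulr_gt0.
  have IC : #|I :&: C s|%:R <= #|C s|%:R :> R.
    by rewrite ler_nat subset_leq_card // finset.subsetIr.
  rewrite sumE sum_belowE ?(ltr0n R) -?(ltr0n R) // -mulrBl normrM (ger0_norm (ltW i0)).
  apply: (@le_trans _ _ (6 * eps * #|I :&: C s|%:R)); last first.
    by rewrite ler_wpM2l // mulr_ge0 // ltW.
  rewrite ler_wpM2r ?(ltW i0) //.
  apply: (@near_near_id _ eps (f s)) => //.
  by apply: unif; rewrite ?finset.subsetIr // ltW.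
rewrite -sumE (sum_interval_partition R _ _ _ _ part) (le_trans (ler_normD _ _)) //.
have IC0 : `|\sum_(x in I :&: C0) E x| <= eps * n%:R.
  apply: (le_trans (triv _)); apply: le_trans cC0.
  by rewrite ler_nat subset_leq_card // finset.subsetIr.
have Cn : \sum_s #|C s|%:R <= n%:R :> R.
  rewrite -natr_sum ler_nat -[leqRHS](card_interval_partition R _ _ _ _ part).
  exact: leq_addl.
have : `|\sum_s \sum_(x in I :&: C s) E x| <= 6 * eps * \sum_s #|C s|%:R.
  rewrite mulr_sumr (le_trans (ler_norm_sum _ _ _)) //.
  by apply: ler_sum => s _; apply: piece.
have : 6 * eps * \sum_s #|C s|%:R <= 6 * eps * n%:R.
  by rewrite ler_wpM2l // mulr_ge0 // ltW.
by lra.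
Qed.

(** The values in [J = [a, b)] are those below [b] minus those below [a], and each count errs by at
    most [7 * (eps * n)]. *)
Lemma perm_discrepancy_near_id (R : realType) (n k : nat) (sigma : 'S_n)
    (eps : R) (f : 'I_k -> R -> R) (C0 : {set 'I_n}) (C : 'I_k -> {set 'I_n}) :
  (0 < n)%N -> 0 < eps -> uniform_partition sigma eps f C0 C ->
  (forall s, eps_near (2 * eps) (f s) id) ->
  perm_discrepancy R sigma <= 14 * (eps * n%:R).
Proof.
move=> n0 e0 unif f_id; have n0' : 0 < n%:R :> R by rewrite ltr0n.
have pos : 0 <= 14 * (eps * n%:R) by rewrite !mulr_ge0 // ltW.
apply: bigmax_le => // I oI; apply: bigmax_le => // J.
move=> /ord_intervalP[a [b [bn ->]]]; rewrite /set_discrepancy.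
rewrite (card_ord_interval R) // card_imset; last exact: perm_inj.
have [ba|ab] := leqP b a.
  rewrite (_ : [set x | _]%SET = finset.set0) ?finset.setI0 ?cards0; last first.
    by apply/setP => x; rewrite !inE; lia.
  by move: ba; rewrite -subn_eq0 => /eqP ->; rewrite !(mulr0, mul0r, subrr, normr0).
have below_n (d : nat) (x : 'I_n) :
    below R n sigma x (d%:R / n%:R) = (sigma x < d)%N%:R.
  by rewrite /below divfK ?gt_eqF // ltr_nat.
have d01 (d : nat) : (d <= n)%N -> 0 <= (d%:R / n%:R : R) <= 1.
  by move=> dn; rewrite divr_ge0 //= ler_pdivrMr // mul1r ler_nat.
have near d dn := sum_below_near_id _ _ _ _ _ _ _ _ e0 unif f_id I (d%:R / n%:R) oI (d01 d dn).
have := near b bn; have := near a (leq_trans (ltnW ab) bn).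
have -> : #|(sigma @: I) :&: [set x : 'I_n | (a <= x)%N && (x < b)%N]|%:R =
    \sum_(x in I) below R n sigma x (b%:R / n%:R)
    - \sum_(x in I) below R n sigma x (a%:R / n%:R) :> R.
  rewrite -sum1_card natr_sum.
  rewrite (eq_bigl (fun y : 'I_n => (y \in sigma @: I) && ((a <= y)%N && (y < b)%N)));
    last by move=> y; rewrite !inE.
  rewrite big_mkcondr /= big_imset /=; last by move=> x y _ _; apply: perm_inj.
  rewrite -sumrB; apply: eq_bigr => x _; rewrite !below_n.
  have [_|ltxa] := leqP a (sigma x); first by rewrite subr0 /=; case: (_ < b)%N.
  by rewrite (ltn_trans ltxa ab) subrr.
rewrite natrB ?(ltnW ab) //.
have -> : #|I|%:R * (b%:R - a%:R) / n%:R =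
  b%:R / n%:R * #|I|%:R - a%:R / n%:R * #|I|%:R :> R by ring.
by rewrite !ler_norml; lra.
Qed.

(** * Regular blocks as classes of a uniform partition *)

Section RegularPartition.
Variables (R : realType) (n : nat) (sigma : 'S_n).

(** Block averages take functions on [nat], so the indicator is extended by 0 beyond Z_n. *)
Definition below_nat (alpha : R) (y : nat) : R :=
  if insub y is Some x then below R n sigma x alpha else 0.

Lemma below_nat_ord (alpha : R) (x : 'I_n) :
  below_nat alpha x = below R n sigma x alpha.
Proof. by rewrite /below_nat valK. Qed.

Lemma below_nat_itv (alpha : R) y : 0 <= below_nat alpha y <= 1.
Proof.
by rewrite /below_nat; case: insubP => [x _ _|_]; rewrite ?below_itv ?lexx ?ler01.
Qed.

Lemma sum_below_nat (alpha : R) (a b : nat) : (b <= n)%N ->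
  \sum_(x in [set x : 'I_n | (a <= x)%N && (x < b)%N]%SET) below R n sigma x alpha
  = \sum_(a <= y < b) below_nat alpha y.
Proof.
move=> bn; rewrite -(sum_ord_interval R n) //.
by apply: eq_bigr => x _; rewrite below_nat_ord.
Qed.

Definition block (L p : nat) : {set 'I_n} :=
  [set x : 'I_n | (p * L <= x)%N && (x < p.+1 * L)%N]%SET.

Lemma card_block L p : (p.+1 * L <= n)%N -> #|block L p| = L.
Proof. by move=> pn; rewrite (card_ord_interval R) // mulSn addnK. Qed.

Lemma image_cdf_block (alpha : R) L p : (p.+1 * L <= n)%N ->
  image_cdf sigma (block L p) alpha = block_avg R (below_nat alpha) L p.
Proof. by move=> pn; rewrite image_cdfE card_block // sum_below_nat. Qed.

(** With [delta = eps ^+ 2 / 4], the sum over [I] errs by at most [2 * (K * L * delta + L)]. The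
    choice of [K] gives [L <= K * L * delta], so this is at most [eps ^+ 2 * (K * L)], while [I] has
    at least [eps * (K * L)] points. *)
Lemma regular_block_cdf (alpha : R) (K L p : nat) (eps : R) (I : {set 'I_n}) :
    (0 < K)%N -> (0 < L)%N -> 0 < eps -> K%:R^-1 <= eps ^+ 2 / 4 ->
    (p.+1 * (K * L) <= n)%N ->
    spread R (below_nat alpha) L K p <= (eps ^+ 2 / 4) ^+ 2 ->
    ord_interval I -> I \subset block (K * L) p ->
    eps * #|block (K * L) p|%:R <= #|I|%:R ->
  `|image_cdf sigma I alpha - image_cdf sigma (block (K * L) p) alpha| <= eps.
Proof.
move=> K0 L0 e0 K_large pn reg /ord_intervalP[a [b [bn IE]]] Isub.
rewrite card_block // => Ibig.
have KL0 : 0 < (K * L)%:R :> R by rewrite ltr0n muln_gt0 K0.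
have I0 : 0 < #|I|%:R :> R by apply: lt_le_trans Ibig; rewrite mulr_gt0.
have cI : #|I| = (b - a)%N by rewrite IE (card_ord_interval R).
have ab : (a < b)%N by rewrite -subn_gt0 -cI -(ltr0n R).
have pa : (p * (K * L) <= a)%N.
  have := fintype.subsetP Isub (Ordinal (leq_trans ab bn)).
  by rewrite IE !inE /= leqnn ab => /(_ isT)/andP[].
have bp : (b <= p.+1 * (K * L))%N.
  have b1n : (b.-1 < n)%N by rewrite (leq_trans _ bn) // prednK // (leq_ltn_trans _ ab).
  have := fintype.subsetP Isub (Ordinal b1n).
  rewrite IE !inE /= prednK ?(leq_ltn_trans _ ab) // leqnn andbT.
  by rewrite -ltnS prednK ?(leq_ltn_trans _ ab) // => /(_ isT)/andP[].
have d0 : 0 < eps ^+ 2 / 4 by rewrite divr_gt0 // exprn_gt0.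
have := regular_block_interval _ _ _ _ _ _ _ _ L0 K0 d0 (below_nat_itv alpha) reg
  pa (ltnW ab) bp.
rewrite sumrB sum_nat_range_const -image_cdf_block // -sum_below_nat // -IE -cI.
rewrite sum_belowE ?(ltr0n R) //; last by rewrite -(ltr0n R).
rewrite mulrC -mulrBr normrM (ger0_norm (ltW I0)) => bound.
rewrite -(ler_pM2l I0) (le_trans bound) //.
have LK : L%:R <= (K * L)%:R * (eps ^+ 2 / 4) :> R.
  have -> : L%:R = (K * L)%:R * K%:R^-1 :> R.
    by rewrite natrM mulrAC divff ?mul1r // pnatr_eq0 -lt0n.
  by rewrite ler_wpM2l // ltW.
have : eps * (K * L)%:R * eps <= #|I|%:R * eps by rewrite ler_wpM2r // ltW.
have -> : eps * (K * L)%:R * eps = 4 * ((K * L)%:R * (eps ^+ 2 / 4)) by field.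
by lra.
Qed.

(** Regularity is known only at the grid points [i / m]. As distribution functions are monotone,
    [alpha] may be replaced by a grid point within [eps], and nearness absorbs this shift. *)
Lemma regular_block_near (m K L p : nat) (eps : R) (I : {set 'I_n}) :
    (0 < m)%N -> m%:R^-1 <= eps ->
    (0 < K)%N -> (0 < L)%N -> 0 < eps -> K%:R^-1 <= eps ^+ 2 / 4 ->
    (p.+1 * (K * L) <= n)%N ->
    (forall i : 'I_m.+1,
      spread R (below_nat (i%:R / m%:R)) L K p <= (eps ^+ 2 / 4) ^+ 2) ->
    ord_interval I -> I \subset block (K * L) p ->
    eps * #|block (K * L) p|%:R <= #|I|%:R ->
  eps_near eps (image_cdf sigma I) (image_cdf sigma (block (K * L) p)).
Proof.
move=> m0 m_large K0 L0 e0 K_large pn reg oI Isub Ibig alpha a01.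
have m0' : 0 < m%:R :> R by rewrite ltr0n.
have grid (i : nat) : (i <= m)%N ->
    `|image_cdf sigma I (i%:R / m%:R)
      - image_cdf sigma (block (K * L) p) (i%:R / m%:R)| <= eps.
  rewrite -ltnS => im.
  exact: (regular_block_cdf _ _ _ _ _ _ K0 L0 e0 K_large pn (reg (Ordinal im)) oI).
have am0 : 0 <= alpha * m%:R by apply: mulr_ge0; lra.
have := truncn_itv am0; set i := Num.trunc _ => /andP[im1 im2].
have lo : i%:R / m%:R <= alpha by rewrite ler_pdivrMr.
have hi : alpha <= i.+1%:R / m%:R by rewrite ler_pdivlMr // ltW.
have step : i.+1%:R / m%:R = i%:R / m%:R + m%:R^-1 :> R.
  by rewrite -natr1 mulrDl mul1r.
have im : (i <= m)%N.
  by rewrite -(ler_nat R) (le_trans im1) // ler_piMl //; lra.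
have i0 : 0 <= i%:R / m%:R :> R by rewrite divr_ge0.
apply/andP; split.
  have := grid i im; have := le_image_cdf R n sigma I _ _ lo.
  have : clip01 (alpha - eps) <= i%:R / m%:R by apply: clip01_le; lra.
  move=> /(le_image_cdf R n sigma (block (K * L) p)).
  by rewrite ler_norml; lra.
(* The grid point above [alpha]: normally [i.+1], but [m] itself if [i = m], when [alpha] is 1. *)
have [j jm [aj je]] : exists2 j, (j <= m)%N &
    alpha <= j%:R / m%:R /\ j%:R / m%:R <= clip01 (alpha + eps).
  move: im; rewrite leq_eqVlt => /predU1P[im|im].
    have mm : m%:R / m%:R = 1 :> R by rewrite divff // gt_eqF.
    move: hi step; rewrite im mm => hi step; exists m => //; rewrite mm.
    by split; [lra|apply: clip01_ge; move: lo; rewrite im mm; lra].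
  exists i.+1 => //; split=> //; apply: clip01_ge; last by lra.
  by rewrite ler_pdivrMr // mul1r ler_nat.
have := grid j jm; have := le_image_cdf R n sigma I _ _ aj.
have := le_image_cdf R n sigma (block (K * L) p) _ _ je.
by rewrite ler_norml; lra.
Qed.

End RegularPartition.

(* A regularity lemma: take as classes the regular blocks of a well chosen
   level; the other blocks and the remainder of the division go to [C0]. *)
Lemma exists_uniform_partition (R : realType) (eps : R) : 0 < eps ->
  exists M n0 : nat, forall (n : nat) (sigma : 'S_n), (n0 <= n)%N ->
  exists2 k, (k <= M)%N &
  exists (f : 'I_k -> R -> R) (C0 : {set 'I_n}) (C : 'I_k -> {set 'I_n}),
    (forall s, unit_interval_map (f s)) /\ uniform_partition sigma eps f C0 C.
Proof.
move=> e0.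
have d0 : 0 < eps ^+ 2 / 4 by rewrite divr_gt0 // exprn_gt0.
have bnd (x : R) : 0 < x -> exists2 N, (0 < N)%N & N%:R^-1 <= x.
  move=> x0; have h := archi_boundP (ltW (_ : 0 < x^-1)).
  exists (Num.bound x^-1).
    by rewrite -(ltr0n R) (lt_trans _ (h _)) // invr_gt0.
  by rewrite invf_ple ?posrE ?ltW ?h ?invr_gt0 // (lt_trans _ (h _)) ?invr_gt0.
have [m m0 m_large] := bnd _ e0.
have [K K0 K_large] := bnd _ d0.
have e2 : 0 < eps / 2 by rewrite divr_gt0.
have [T reg] := exists_regular_level R m.+1 K _ _ K0 d0 e2.
(* A level has at most [M] blocks, whatever [n] is. *)
pose M := (K ^ T)%N.
have M0 : (0 < M)%N by rewrite expn_gt0 K0.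
(* From [n1] on, the remainder of [n] modulo [M] is at most [eps / 2 * n]. *)
have [n1 n1_gt0 n1_large] : exists2 N, (0 < N)%N & N%:R^-1 <= eps / 2 / M%:R.
  by apply: bnd; rewrite divr_gt0 // ltr0n.
exists M, (maxn M n1) => n sigma; rewrite geq_max => /andP[Mn n1n].
(* The length of the finest blocks, those of level [T]. *)
pose q := (n %/ M)%N.
have q0 : (0 < q)%N by rewrite divn_gt0.
have n0' : 0 < n%:R :> R by rewrite ltr0n (leq_trans M0).
have M_small : M%:R <= eps / 2 * n%:R.
  have n1_pos : 0 < n1%:R :> R by rewrite ltr0n.
  rewrite ler_pdivlMr ?ltr0n // mulrC ler_pdivrMr // in n1_large.
  by rewrite (le_trans n1_large) // ler_wpM2l ?ler_nat // ltW.
pose g (i : 'I_m.+1) := below_nat R n sigma (i%:R / m%:R).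
have [|t tT irr] := reg q g q0; first by move=> i y; apply: below_nat_itv.
set L := (q * K ^ (T - t.+1))%N in irr.
set irrs := irregular_blocks _ _ _ _ _ _ in irr.
have L0 : (0 < L)%N by rewrite muln_gt0 q0 expn_gt0 K0.
have KLM : (K ^ t * (K * L) = q * M)%N.
  rewrite /L (_ : M = K ^ t * K * K ^ (T - t.+1))%N; last first.
    by rewrite -expnSr -expnD subnKC.
  ring.
have KLn : (K ^ t * (K * L) <= n)%N by rewrite KLM leq_divM.
have blk_n (p : 'I_(K ^ t)) : (p.+1 * (K * L) <= n)%N.
  by apply: leq_trans KLn; rewrite leq_mul2r ltn_ord orbT.
pose k := #|~: irrs|.
pose C (s : 'I_k) := block n (K * L) (enum_val s).
pose C0 := ~: \bigcup_s C s.
have cC s : #|C s| = (K * L)%N by apply: (card_block R).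
have part : interval_partition C0 C.
  split.
  - by rewrite finset.setUC finset.setUCr.
  - move=> s; rewrite disjoint_sym finset.disjoints_subset finset.setCK.
    exact: finset.bigcup_sup.
  - move=> s u su; rewrite -finset.setI_eq0; apply/eqP/setP => x.
    rewrite !inE; apply/negbTE; apply: contra su.
    move=> /andP[/andP[s1 s2] /andP[u1 u2]].
    apply/eqP/enum_val_inj/val_inj/eqP => /=; rewrite eqn_leq.
    have KL0 : (0 < K * L)%N by rewrite muln_gt0 K0.
    rewrite -ltnS -(ltn_pmul2r KL0) (leq_ltn_trans s1 u2) /=.
    by rewrite -ltnS -(ltn_pmul2r KL0) (leq_ltn_trans u1 s2).
  - by move=> s; rewrite cC muln_gt0 K0.
  - move=> s; apply/ord_intervalP.
    by exists (enum_val s * (K * L))%N, ((enum_val s).+1 * (K * L))%N.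
exists k.
  rewrite /k (leq_trans (max_card _)) // card_ord leq_pexp2l //.
  exact: ltnW.
exists (fun s => image_cdf sigma (C s)), C0, C.
split; first by move=> s x _; apply: image_cdf_itv.
split=> //.
- by move=> s u; rewrite !cC.
- have := card_interval_partition R _ _ _ _ part.
  under eq_bigr do rewrite cC.
  rewrite sum_nat_const card_ord => cardn.
  have ki : (#|irrs| + k = K ^ t)%N by rewrite cardsC card_ord.
  have nqr : n = ((#|irrs| + k) * (K * L) + n %% M)%N.
    by rewrite ki KLM -divn_eq.
  (* The remainder and the irregular blocks each use half of the allowance [eps * n]. *)
  have C0E : (#|C0| = n %% M + #|irrs| * (K * L))%N.
    apply/eqP; rewrite -(eqn_add2r (k * (K * L))) cardn [X in X == _]nqr.
    by rewrite mulnDl addnC addnA.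
  rewrite C0E natrD.
  have rM : (n %% M)%:R <= M%:R :> R by rewrite ler_nat ltnW // ltn_mod.
  have iE : (#|irrs| * (K * L))%:R <= eps / 2 * n%:R.
    rewrite natrM (le_trans (ler_wpM2r _ irr)) // -(mulrA (eps / 2)) -natrM.
    by rewrite ler_wpM2l ?ler_nat // ltW.
  by lra.
- move=> s I oI Isub Ibig.
  apply: (regular_block_near _ _ _ m K L) => // i.
  have := enum_valP s; rewrite !inE negb_exists => /forallP/(_ i).
  by rewrite -leNgt.
Qed.

Theorem proposition8 (R : realType) (n : nat -> nat)
    (sigma : forall i : nat, 'S_(n i)) (n_infty : n @ \oo --> \oo) :
  quasirandom R sigma <->
  (forall (eps : R) (k : nat), 0 < eps ->
     \forall i \near \oo,
       forall (f : 'I_k -> R -> R)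
              (C0 : {set 'I_(n i)}) (C : 'I_k -> {set 'I_(n i)}),
         (forall s : 'I_k, unit_interval_map (f s)) ->
         uniform_partition (sigma i) eps f C0 C ->
         forall s : 'I_k, eps_near (2 * eps) (f s) (fun x : R => x)).
Proof.
have n_large (r : R) : \forall i \near \oo, r <= (n i)%:R.
  exact: (n_infty _ (nbhs_infty_ger r)).
rewrite /quasirandom; split.
  move=> /eqoP small eps k e0.
  (* The factor 2 leaves room for the added 1 in [discrepancy_sum_below]; [k.+1] avoids dividing by
     zero. *)
  pose c : R := eps / (2 * k.+1%:R).
  have c0 : 0 < c by rewrite divr_gt0 // mulr_gt0.
  have smallc := small _ c0; have nc := n_large c^-1.
  near=> i => f C0 C f01 unif.
  apply: (near_id_of_small_discrepancy _ _ _ _ _ _ _ _ e0 f01 unif).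
  have D_le : perm_discrepancy R (sigma i) <= c * (n i)%:R.
    apply: le_trans (ler_norm _) _.
    rewrite -[X in _ <= c * X]ger0_norm //; near: i; exact: smallc.
  have n_ge : 1 <= c * (n i)%:R.
    by rewrite mulrC -ler_pdivrMr // mul1r; near: i.
  have -> : eps * (n i)%:R = k.+1%:R * (c * (n i)%:R + c * (n i)%:R).
    by rewrite /c; field.
  apply: ler_pM; rewrite ?ler_nat // ?lerD //.
  apply: addr_ge0 => //; apply: bigmax_ge_id.
move=> near_id; apply/eqoP => e e0.
(* 14 is the constant of [perm_discrepancy_near_id]. *)
pose eps : R := e / 14; have eps0 : 0 < eps by rewrite divr_gt0.
have [M [n0 reg]] := exists_uniform_partition _ _ eps0.
(* The number of classes varies with [i] but is at most [M], and finitely many eventual properties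
   eventually hold together. *)
have near_id_upto : \forall i \near \oo, forall k, (k <= M)%N ->
    forall (f : 'I_k -> R -> R) (C0 : {set 'I_(n i)}) (C : 'I_k -> {set 'I_(n i)}),
    (forall s, unit_interval_map (f s)) -> uniform_partition (sigma i) eps f C0 C ->
    forall s, eps_near (2 * eps) (f s) id.
  elim: M {reg} => [|M IHM].
    near=> i => k; rewrite leqn0 => /eqP ->; near: i; exact: near_id.
  near=> i => k; rewrite leq_eqVlt => /predU1P[->|].
    near: i; exact: near_id.
  rewrite ltnS; move: k; near: i; exact: IHM.
near=> i.
have n_gt0 : (0 < n i)%N by rewrite -(ltr0n R) (lt_le_trans ltr01) //; near: i.
have n_ge : (n0 <= n i)%N by rewrite -(ler_nat R); near: i.
have [k kM [f [C0 [C [f01 unif]]]]] := reg _ (sigma i) n_ge.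
have f_id : forall s, eps_near (2 * eps) (f s) id.
  by move: f01 unif; apply: (near near_id_upto i).
rewrite !ger0_norm //; last exact: bigmax_ge_id.
have := perm_discrepancy_near_id _ _ _ _ _ _ _ _ n_gt0 eps0 unif f_id.
by rewrite /eps mulrA (mulrC 14) divfK.
Unshelve. all: by end_near. Qed.
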